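(* Let $k$ be any field. For each fixed $r\ge 1$ and fixed $r$-multigrading $J\in\mathbb{Z}_{\ge 0}^r$, there is an integer-valued polynomial $P(T)=P_{r,J,k}(T)\in\mathbb{Q}[T]$ such that for all sufficiently large $n$, the dimension of the $J$-graded piece of the $r$-diagonal coinvariant algebra is given by $$\dim_k R^{(r)}_J(n)=P(n).$$
   Context: For positive integers $r,n$ let $k[\mathbf{X}^{(r)}(n)]=k[x_1^{(1)},\dots,x_n^{(1)},\dots,x_1^{(r)},\dots,x_n^{(r)}]$, with $S_n$ acting diagonally (permuting the lower indices simultaneously in all $r$ sets of variables). Let $I_n$ be the ideal generated by the $S_n$-invariant polynomials with vanishing constant term. The $r$-diagonal coinvariant algebra is $R^{(r)}(n)=k[\mathbf{X}^{(r)}(n)]/I_n$. The polynomial algebra is multigraded by $J=(j_1,\dots,j_r)$, where $j_i$ is the total degree in $x_1^{(i)},\dots,x_n^{(i)}$; this descends to a multigrading $R^{(r)}(n)=\bigoplus_J R^{(r)}_J(n)$. *)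

(* Defs.v *)
From HB Require Import structures.
From mathcomp Require Import all_boot all_order all_fingroup all_algebra.
From mathcomp Require Import boolp.
From mathcomp Require Import mpoly.

Set Implicit Arguments.
Unset Strict Implicit.
Unset Printing Implicit Defensive.

Import GRing.Theory.

Local Open Scope ring_scope.
Local Open Scope quotient_scope.

(* The variable x_j^(i) is 'X_(mxvec_index i j), for i : 'I_r and j : 'I_n,
   so that k[X^(r)(n)] is {mpoly k[r * n]}. *)

Section Action.
Variables (r n : nat).

(* The permutation of the variables sending x_j^(i) to x_(s j)^(i). *)
Definition diag_idx (s : 'S_n) (v : 'I_(r * n)) : 'I_(r * n) :=
  mxvec (\matrix_(i < r, j < n) mxvec_index i (s j)) 0 v.

Lemma diag_idxE (s : 'S_n) (i : 'I_r) (j : 'I_n) :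
  diag_idx s (mxvec_index i j) = mxvec_index i (s j).
Proof. by rewrite /diag_idx mxvecE mxE. Qed.

Lemma diag_idx_inj (s : 'S_n) : injective (diag_idx s).
Proof.
apply: (can_inj (g := diag_idx (s^-1)%g)) => v.
by case/mxvec_indexP: v => i j; rewrite !diag_idxE permK.
Qed.

Definition diag_perm (s : 'S_n) : 'S_(r * n) := perm (@diag_idx_inj s).

Variable k : fieldType.

Definition diag_act (s : 'S_n) (p : {mpoly k[r * n]}) : {mpoly k[r * n]} :=
  msym (diag_perm s) p.

Lemma diag_actX (s : 'S_n) (i : 'I_r) (j : 'I_n) :
  diag_act s 'X_(mxvec_index i j) = 'X_(mxvec_index i (s j)).
Proof.
rewrite /diag_act /msym mmapX mmap1U.
by rewrite permE diag_idxE.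
Qed.

Definition diag_invariant (p : {mpoly k[r * n]}) : Prop :=
  forall s : 'S_n, diag_act s p = p.

Definition diag_ideal_spec (p : {mpoly k[r * n]}) : Prop :=
  exists2 qf : seq ({mpoly k[r * n]} * {mpoly k[r * n]}),
    (forall x, x \in qf -> diag_invariant x.2 /\ x.2@_0%MM = 0) &
    p = \sum_(x <- qf) x.1 * x.2.

Definition diag_ideal (p : {mpoly k[r * n]}) : bool := `[< diag_ideal_spec p >].

Lemma diag_ideal_closed : idealr_closed diag_ideal.
Proof.
split.
- by apply/asboolP; exists [::]; rewrite ?big_nil.
- apply/negP => /asboolP[qf qfP] /(congr1 (mcoeff 0%MM)).
  rewrite raddf_sum /= big1_seq ?mcoeff1 ?eqxx; last first.
    by move=> x /= /qfP[_ x0]; rewrite rmorphM /= x0 mulr0.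
  by move/eqP; rewrite oner_eq0.
- move=> a u v /asboolP[qu quP uE] /asboolP[qv qvP vE].
  apply/asboolP; exists ([seq (a * x.1, x.2) | x <- qu] ++ qv).
    by move=> x; rewrite mem_cat => /orP[/mapP[y /quP yP ->]|/qvP].
  rewrite big_cat big_map /= uE vE mulr_sumr; congr (_ + _).
  by apply: eq_bigr => x _; rewrite mulrA.
Qed.

HB.instance Definition _ :=
  isIdealr.Build {mpoly k[r * n]} diag_ideal diag_ideal_closed.

End Action.

Section HasDim.
Variables (k : fieldType) (V : lmodType k).

(* [has_dim W d]: the subspace W of V has a basis with d elements; V itself is
   not assumed to be finite dimensional. *)
Definition has_dim (W : V -> Prop) (d : nat) : Prop :=
  exists b : 'I_d -> V,
    [/\ forall i, W (b i),
        forall c : 'I_d -> k, \sum_i c i *: b i = 0 -> forall i, c i = 0 &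
        forall v, W v -> exists c : 'I_d -> k, v = \sum_i c i *: b i].

Lemma has_dim_leq (W : V -> Prop) (d e : nat) :
  has_dim W d -> has_dim W e -> (d <= e)%N.
Proof.
case=> b [bW b_free _] [b' [_ _ b'_span]].
have [M bE] : {M : 'M[k]_(d, e) | forall i, b i = \sum_j M i j *: b' j}.
  have h i : {c : 'I_e -> k | b i = \sum_j c j *: b' j}.
    exact/cid/b'_span.
  exists (\matrix_(i, j) projT1 (h i) j) => i; rewrite {1}(projT2 (h i)).
  by apply: eq_bigr => j _; rewrite mxE.
suff : row_free M by rewrite /row_free => /eqP <-; exact: rank_leq_col.
apply: inj_row_free => u uM0; apply/rowP => i; rewrite mxE.
apply: (b_free (u 0)).
under eq_bigr => l _ do rewrite bE scaler_sumr.
rewrite exchange_big /= big1 // => j _.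
under eq_bigr => l _ do rewrite scalerA.
rewrite -scaler_suml; move/rowP/(_ j): uM0; rewrite !mxE => ->.
by rewrite scale0r.
Qed.

Lemma has_dim_inj (W : V -> Prop) (d e : nat) :
  has_dim W d -> has_dim W e -> d = e.
Proof.
by move=> Wd We; apply/eqP; rewrite eqn_leq !(has_dim_leq Wd, has_dim_leq We).
Qed.

End HasDim.

Section Coinvariants.
Variables (k : fieldType) (r n : nat).

Definition diag_idealr : idealr {mpoly k[r * n]} := @diag_ideal r n k.

Definition coinv : Type := {ideal_quot diag_idealr}.

HB.instance Definition _ := GRing.ComNzRing.on coinv.

Definition coinv_pi (p : {mpoly k[r * n]}) : coinv :=
  \pi_{ideal_quot diag_idealr} p.

Lemma coinv_pi_is_zmod_morphism : zmod_morphism coinv_pi.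
Proof. exact: raddfB. Qed.

Lemma coinv_pi_is_monoid_morphism : monoid_morphism coinv_pi.
Proof. by split=> [|p q]; rewrite /coinv_pi ?rmorph1 ?rmorphM. Qed.

HB.instance Definition _ :=
  GRing.isZmodMorphism.Build _ _ coinv_pi coinv_pi_is_zmod_morphism.
HB.instance Definition _ :=
  GRing.isMonoidMorphism.Build _ _ coinv_pi coinv_pi_is_monoid_morphism.

Lemma coinv_pi_surj (u : coinv) : exists p, u = coinv_pi p.
Proof. by exists (generic_quotient.repr u); rewrite /coinv_pi reprK. Qed.

Lemma coinv_pi_eq0 p : (coinv_pi p == 0) = diag_ideal p.
Proof.
by rewrite -(rmorph0 coinv_pi) -[LHS]Quotient.idealrBE subr0.
Qed.

Definition coinv_scale (c : k) (u : coinv) : coinv := coinv_pi c%:MP * u.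

Lemma coinv_scaleA a b u : coinv_scale a (coinv_scale b u) = coinv_scale (a * b) u.
Proof. by rewrite /coinv_scale mulrA -rmorphM /= -mpolyCM. Qed.

Lemma coinv_scale1 : left_id 1 coinv_scale.
Proof. by move=> u; rewrite /coinv_scale mpolyC1 rmorph1 mul1r. Qed.

Lemma coinv_scaleDr : right_distributive coinv_scale +%R.
Proof. by move=> a u v; rewrite /coinv_scale mulrDr. Qed.

Lemma coinv_scaleDl u : {morph coinv_scale^~ u : a b / a + b}.
Proof. by move=> a b; rewrite /coinv_scale mpolyCD rmorphD mulrDl. Qed.

HB.instance Definition _ := GRing.Zmodule_isLmodule.Build k coinv
  coinv_scaleA coinv_scale1 coinv_scaleDr coinv_scaleDl.

Lemma coinv_scaleAl (a : k) (u v : coinv) : a *: (u * v) = (a *: u) * v.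
Proof. exact: mulrA. Qed.

HB.instance Definition _ :=
  GRing.Lmodule_isLalgebra.Build k coinv coinv_scaleAl.

Lemma coinv_piZ (a : k) p : coinv_pi (a *: p) = a *: coinv_pi p.
Proof. by rewrite -mul_mpolyC rmorphM. Qed.

Definition multidegree (m : 'X_{1..r * n}) (i : 'I_r) : nat :=
  \sum_(j < n) m (mxvec_index i j).

Definition multihomog (J : 'I_r -> nat) (p : {mpoly k[r * n]}) : Prop :=
  forall m, m \in msupp p -> multidegree m =1 J.

Definition coinv_piece (J : 'I_r -> nat) (u : coinv) : Prop :=
  exists2 p, multihomog J p & u = coinv_pi p.

Lemma coinv_piece0 J : coinv_piece J 0.
Proof. by exists 0; rewrite ?raddf0 // => m; rewrite msupp0. Qed.

Lemma coinv_piece_linear J a u v :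
  coinv_piece J u -> coinv_piece J v -> coinv_piece J (a *: u + v).
Proof.
move=> [p pJ ->] [q qJ ->]; exists (a *: p + q).
  by move=> m /msuppD_le; rewrite mem_cat => /orP[/msuppZ_le/pJ|/qJ].
by rewrite rmorphD /= coinv_piZ.
Qed.

End Coinvariants.

(* Main.v *)
From HB Require Import structures.
Require Import Defs.
From mathcomp Require Import all_boot all_order all_fingroup all_algebra.
From mathcomp Require Import boolp mpoly ring.

Set Implicit Arguments.
Unset Strict Implicit.
Unset Printing Implicit Defensive.

Import Order.TTheory GRing.Theory Num.Theory.

Local Open Scope ring_scope.

(* A monomial of k[X^(r)(n)] is a word of length n whose j-th letter is the
   exponent vector in N^r of x_j^(1), ..., x_j^(r). Call a word of multidegree J
   standard if its class in R^(r)(n) is not a linear combination of the classes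
   of lexicographically smaller words; the standard words give a basis of
   R_J^(r)(n). Setting the variables x_p^(i) to 0 for one column p maps I_(n+1)
   into I_n, and it turns a relation expressing a word with zero p-th letter by
   smaller ones into a relation for the word with this letter removed, because
   removing equal letters at the same place preserves the lexicographic order.
   Hence the standard words (over all n) are closed under insertion of the zero
   letter. They have at most |J| nonzero letters, so Dickson's lemma applies to
   such sets. If U is one, splitting off the first letter gives
   h_U(n+1) = h_(U_0)(n) + sum_(a <> 0) h_(U_a)(n), where U_a collects the w with
   aw in U and h_U(n) is the number of words of length n in U. The words of U_a
   have fewer nonzero letters for a <> 0, and U, U_0, U_00, ... is an increasing
   chain, hence stationary, so that h_U is eventually polynomial. *)

(** * Eventually polynomial functions *)

Definition fdiff (f : nat -> int) (n : nat) : int := f n.+1 - f n.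

(* Equivalent to being eventually an integer-valued polynomial: see [ev_polyP]. *)
Definition ev_poly (f : nat -> int) : Prop :=
  exists d N, forall n, (N <= n)%N -> iter d fdiff f n = 0.

Lemma iter_fdiff_shift d f c n :
  iter d fdiff (fun n => f (n + c)%N) n = iter d fdiff f (n + c)%N.
Proof. by elim: d n => //= d IHd n; rewrite /fdiff !IHd addSn. Qed.

Lemma iter_fdiffD d f g n :
  iter d fdiff (fun n => f n + g n) n = iter d fdiff f n + iter d fdiff g n.
Proof.
elim: d n => //= d IHd n; rewrite /fdiff !IHd; ring.
Qed.

Lemma iter_fdiffZ d c f n :
  iter d fdiff (fun n => c * f n) n = c * iter d fdiff f n.
Proof. by elim: d n => //= d IHd n; rewrite /fdiff !IHd mulrBr. Qed.

Lemma eq_iter_fdiff d f g n : f =1 g -> iter d fdiff f n = iter d fdiff g n.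
Proof. by move=> fg; elim: d n => //= d IHd n; rewrite /fdiff !IHd. Qed.

Lemma iter_fdiff_le d e f N : (d <= e)%N ->
  (forall n, (N <= n)%N -> iter d fdiff f n = 0) ->
  forall n, (N <= n)%N -> iter e fdiff f n = 0.
Proof.
move=> /subnK <- H; elim: (e - d)%N => [|m IHm] n Nn; first exact: H.
by rewrite addSn /= /fdiff !IHm ?subrr // ltnW.
Qed.

Lemma eq_ev_poly f g : f =1 g -> ev_poly f -> ev_poly g.
Proof.
by move=> fg [d [N H]]; exists d, N => n /H; rewrite (eq_iter_fdiff _ _ fg).
Qed.

Lemma ev_poly0 : ev_poly (fun=> 0).
Proof. by exists 0%N, 0%N. Qed.

Lemma ev_polyD f g : ev_poly f -> ev_poly g -> ev_poly (fun n => f n + g n).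
Proof.
move=> [d [N Hf]] [e [M Hg]]; exists (maxn d e), (maxn N M) => n.
rewrite geq_max => /andP[Nn Mn]; rewrite iter_fdiffD.
by rewrite (iter_fdiff_le (leq_maxl d e) Hf) ?(iter_fdiff_le (leq_maxr d e) Hg).
Qed.

Lemma ev_poly_sum (I : Type) (s : seq I) (Q : pred I) (F : I -> nat -> int) :
  (forall i, Q i -> ev_poly (F i)) -> ev_poly (fun n => \sum_(i <- s | Q i) F i n).
Proof.
move=> H; elim: s => [|i s IHs].
  by apply: eq_ev_poly ev_poly0 => n; rewrite big_nil.
have [Qi|Qi] := boolP (Q i).
  by apply: eq_ev_poly (ev_polyD (H i Qi) IHs) => n; rewrite big_cons Qi.
by apply: eq_ev_poly IHs => n; rewrite big_cons (negbTE Qi).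
Qed.

Lemma ev_poly_fdiff f : ev_poly (fdiff f) -> ev_poly f.
Proof. by move=> [d [N H]]; exists d.+1, N => n /H; rewrite -iterSr. Qed.

Lemma ev_poly_succ f : ev_poly (fun n => f n.+1) -> ev_poly f.
Proof.
move=> [d [N H]]; exists d, N.+1 => -[//|n] /H.
rewrite -[n.+1]addn1 -iter_fdiff_shift.
by under eq_iter_fdiff do rewrite -addn1.
Qed.

(** * Integer-valued polynomials and binomial coefficients *)

Definition int_valued (P : {poly rat}) : Prop :=
  forall z : int, P.[z%:~R] \is a Num.int.

(** The binomial coefficient $\binom{X}{d}$ as a polynomial. *)
Definition binpoly (d : nat) : {poly rat} :=
  (d`!%:R)^-1 *: \prod_(j < d) ('X - (j%:R)%:P).

Lemma binpoly0 : binpoly 0 = 1.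
Proof. by rewrite /binpoly big_ord0 fact0 invr1 scale1r. Qed.

Lemma binpolyS0 d : (binpoly d.+1).[0] = 0.
Proof.
by rewrite hornerZ horner_prod big_ord_recl hornerXsubC subrr mul0r mulr0.
Qed.

(** Pascal's rule. The two products share the factors $x - j$ for $j < d$; what remains is $(x + 1)
    - (x - d) = d + 1$, which cancels against $(d + 1)!$. *)
Lemma binpoly_diff d x :
  (binpoly d.+1).[x + 1] - (binpoly d.+1).[x] = (binpoly d).[x].
Proof.
rewrite !hornerZ !horner_prod [in LHS]big_ord_recl [X in _ - _ * X]big_ord_recr /=.
have -> : \prod_(i < d) ('X - (lift ord0 i)%:R%:P).[x + 1]
       = \prod_(j < d) ('X - (j%:R : rat)%:P).[x].
  by apply: eq_bigr => i _; rewrite !hornerXsubC /= /bump add1n mulrS; ring.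
set p := \prod_(_ < d) _; rewrite !hornerXsubC factS natrM.
have d0 : (d.+1%:R : rat) != 0 by rewrite pnatr_eq0.
have f0 : (d`!%:R : rat) != 0 by rewrite pnatr_eq0 -lt0n fact_gt0.
have -> : x + 1 - 0%:R = d.+1%:R + (x - d%:R) by rewrite mulrS; ring.
by field; rewrite f0 -mulrS d0.
Qed.

Lemma binpoly_bin d n : (binpoly d).[n%:R] = 'C(n, d)%:R.
Proof.
elim: d n => [|d IHd] n.
  by rewrite bin0 binpoly0 hornerC.
elim: n => [|n IHn]; first by rewrite binpolyS0.
rewrite binS natrD -IHn -IHd -(binpoly_diff d n%:R) mulrSr.
by ring.
Qed.

(** Induction on [z] in both directions: [binpoly_diff] is solved for the value at $x + 1$ going up
    and for the value at $x$ going down. *)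
Lemma binpoly_int d : int_valued (binpoly d).
Proof.
elim: d => [|d IHd] z.
  by rewrite binpoly0 hornerC rpred1.
elim: z => [|n IHn|n IHn]; first by rewrite binpolyS0 rpred0.
  rewrite -[n.+1]addn1 PoszD rmorphD /=.
  by have /eqP := binpoly_diff d n%:~R; rewrite subr_eq => /eqP ->; rewrite rpredD.
have := binpoly_diff d (- n.+1%:~R).
have -> : (- n.+1%:~R + 1 : rat) = (- n%:Z)%:~R.
  by rewrite rmorphN /= -addn1 PoszD rmorphD /= opprD addrNK.
move/eqP; rewrite subr_eq addrC -subr_eq => /eqP <-.
by rewrite rpredB // -rmorphN; apply: IHd.
Qed.

Lemma iter_fdiff_bin d n : iter d fdiff (fun m => 'C(m, d)%:Z) n = 1.
Proof.
elim: d => [|d IHd]; first by rewrite /= bin0.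
rewrite iterSr -{}IHd; apply: eq_iter_fdiff => m.
by rewrite /fdiff binS PoszD addrAC subrr add0r.
Qed.

Lemma fdiff0_const f N : (forall n, (N <= n)%N -> fdiff f n = 0) ->
  forall n, (N <= n)%N -> f n = f N.
Proof.
move=> H n /subnK <-; elim: (n - N)%N => // m IHm.
by rewrite -IHm addSn; apply/eqP; rewrite -subr_eq0; apply/eqP/H/leq_addl.
Qed.

Lemma ev_polyP f : ev_poly f -> exists P : {poly rat},
  int_valued P /\ exists N : nat, forall n, (N <= n)%N -> P.[n%:R] = (f n)%:~R.
Proof.
move=> [d [N]]; elim: d f => [|d IHd] f H.
  exists 0; split=> [z|]; first by rewrite horner0 rpred0.
  by exists N => n /H /= ->; rewrite horner0.
(* The [d]-th difference of [f] is eventually the constant [c]. Subtracting [c] times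
   $\binom{n}{d}$, whose [d]-th difference is 1, lowers the order by one. *)
set c := iter d fdiff f N.
have cE := fdiff0_const H.
have [|P [Pint [M PE]]] := IHd (fun n => f n + - c * 'C(n, d)%:Z).
  move=> n /cE fn; rewrite iter_fdiffD iter_fdiffZ iter_fdiff_bin.
  by rewrite [X in X + _]fn mulr1 subrr.
exists (P + c%:~R *: binpoly d); split=> [z|].
  by rewrite hornerD hornerZ rpredD ?rpredM ?binpoly_int ?intr_int.
exists M => n /PE; rewrite hornerD hornerZ binpoly_bin => ->.
by rewrite rmorphD rmorphM rmorphN /=; ring.
Qed.

(** * Counting words *)

Lemma chain_subpred (T : Type) (C : nat -> pred T) :
  (forall s, subpred (C s) (C s.+1)) ->
  forall s t, (s <= t)%N -> subpred (C s) (C t).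
Proof.
move=> CS s t /subnK <-; elim: (t - s)%N => // m IHm x /IHm.
by rewrite addSn; apply: CS.
Qed.

Definition stabilizes (T : Type) (C : nat -> pred T) : Prop :=
  exists S, forall s, (S <= s)%N -> C s =1 C S.

Lemma common_bound (I : finType) (Q : I -> nat -> Prop) :
  (forall i S S', (S <= S')%N -> Q i S -> Q i S') ->
  (forall i, exists S, Q i S) -> exists S, forall i, Q i S.
Proof.
move=> Qmono /choice[S QS]; exists (\max_i S i)%N => i.
by apply: Qmono (QS i); apply: leq_bigmax.
Qed.

Lemma stabilizes_from_leq (T : Type) (C : nat -> pred T) S S' : (S <= S')%N ->
  (forall s, (S <= s)%N -> C s =1 C S) -> (forall s, (S' <= s)%N -> C s =1 C S').
Proof. by move=> SS H s S's x; rewrite (H s) ?(H S') // (leq_trans SS). Qed.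

(** If the diagonal is stationary from [D] on, then so is the whole quadrant $s, g \ge D$. Only the
    finitely many columns $g < D$ remain, and their bounds have a maximum. *)
Lemma stabilizes_double (T : Type) (C : nat -> nat -> pred T) :
  (forall s g, subpred (C s g) (C s.+1 g)) ->
  (forall s g, subpred (C s g) (C s g.+1)) ->
  stabilizes (fun s => C s s) -> (forall g, stabilizes (C^~ g)) ->
  exists S, forall s, (S <= s)%N -> forall g, C s g =1 C S g.
Proof.
move=> Cs Cg [D HD] Hg.
have ms g := chain_subpred (fun s => Cs s g).
have mg s := chain_subpred (Cg s).
have [||S HS] := @common_bound 'I_D
    (fun g S => forall s, (S <= s)%N -> C s g =1 C S g).
- by move=> g S S'; apply: stabilizes_from_leq.
- by move=> g; apply: Hg.
exists (maxn D S) => s; rewrite geq_max => /andP[Ds Ss] g x.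
have [gD|Dg] := ltnP g D.
  by rewrite (HS (Ordinal gD) s Ss) (HS (Ordinal gD) _ (leq_maxr _ _)).
(* [C t g] lies between [C D D] and the diagonal term at [maxn t g], which are equal. *)
have key t : (D <= t)%N -> C t g x = C D D x.
  move=> Dt; apply/idP/idP => [Ctg|CDD].
    rewrite -(HD (maxn t g)) ?leq_max ?Dt //.
    by apply: mg (leq_maxr t g) _ _; apply: ms (leq_maxl t g) _ _.
  by apply: mg Dg _ _; apply: ms Dt _ _.
by rewrite !key ?leq_maxl.
Qed.

Lemma stabilizes_unit (C : nat -> pred unit) :
  (forall s, subpred (C s) (C s.+1)) -> stabilizes C.
Proof.
move=> CS; have [[S CSt]|nC] := pselect (exists S, C S tt).
  by exists S => s Ss [] /=; rewrite CSt (chain_subpred CS Ss).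
exists 0%N => s _ [] /=.
have nCs t : C t tt = false by apply/negP => Ct; apply: nC; exists t.
by rewrite !nCs.
Qed.

Section Words.
Variables (L : finType) (z : L).
Implicit Types (U : pred (seq L)) (w : seq L).

Definition insertion_closed U : Prop := forall u v, U (u ++ v) -> U (u ++ z :: v).

Definition letters_below (d : nat) U : Prop :=
  forall w, U w -> (count (predC1 z) w < d)%N.

Lemma insertion_closed_cat U u :
  insertion_closed U -> insertion_closed (fun w => U (u ++ w)).
Proof. by move=> HU v w; rewrite !catA; apply: HU. Qed.

Lemma insertion_closed_cons U : insertion_closed U ->
  forall w, U w -> U (z :: w).
Proof. by move=> HU w; apply: (HU [::]). Qed.

Lemma insertion_closed_nseq U u : insertion_closed U -> forall g,
  subpred (fun w => U (nseq g z ++ u ++ w)) (fun w => U (nseq g.+1 z ++ u ++ w)).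
Proof. by move=> HU g w; apply: insertion_closed_cons. Qed.

Lemma nseq_or_split w : w = nseq (size w) z \/
  exists g a w', a != z /\ w = nseq g z ++ a :: w'.
Proof.
elim: w => [|a w [->|[g [b [w' [bz ->]]]]]]; first by left.
  have [->|az] := eqVneq a z; first by left; rewrite /= size_nseq.
  by right; exists 0%N, a, (nseq (size w) z).
have [->|az] := eqVneq a z; first by right; exists g.+1, b, w'.
by right; exists 0%N, a, (nseq g z ++ b :: w').
Qed.

Lemma letters_below_split d U g a : a != z -> letters_below d.+1 U ->
  letters_below d (fun w => U (nseq g z ++ a :: w)).
Proof.
move=> az HU w /HU; rewrite count_cat /= az add1n addnS ltnS.
by apply: leq_trans; rewrite ltnS leq_addl.
Qed.

(* Dickson's lemma, in the form of the ascending chain condition. *)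
Lemma insertion_chain_stabilizes d (C : nat -> pred (seq L)) :
  (forall s, insertion_closed (C s)) -> (forall s, letters_below d (C s)) ->
  (forall s, subpred (C s) (C s.+1)) -> stabilizes C.
Proof.
elim: d C => [|d IHd] C Cins Clet Cmono.
  exists 0%N => s _ w; have n t : C t w = false by apply/negP => /Clet.
  by rewrite !n.
(* Words consisting of zero letters only; membership is viewed as a predicate on a one-point
   type. *)
have [S0 H0] : exists S, forall s, (S <= s)%N -> forall g,
    C s (nseq g z) = C S (nseq g z).
  have [||||S H] := @stabilizes_double unit (fun s g _ => C s (nseq g z)).
  - by move=> s g _; apply: Cmono.
  - by move=> s g _; apply: insertion_closed_cons.
  - apply: stabilizes_unit => s _ H; apply: Cmono.
    exact: insertion_closed_cons.
  - by move=> g; apply: stabilizes_unit => s _; apply: Cmono.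
  by exists S => s Ss g; apply: (H s Ss g tt).
(* The other words are sorted by their first nonzero letter [a], which is preceded by [g] zeros.
   Both the diagonal and each column of the family indexed by [s] and [g] fall under the induction
   hypothesis, as [a] uses up one nonzero letter. *)
have [||S1 H1] := @common_bound L (fun a S => a != z -> forall s, (S <= s)%N ->
    forall g, (fun w => C s (nseq g z ++ a :: w)) =1
    (fun w => C S (nseq g z ++ a :: w))).
- move=> a S S' SS H az s S's g w.
  by rewrite (H az s) ?(H az S') // (leq_trans SS).
- move=> a; have [->|az] := eqVneq a z; first by exists 0%N.
  have [||||S H] := @stabilizes_double _ (fun s g w => C s (nseq g z ++ a :: w)).
  + by move=> s g w; apply: Cmono.
  + by move=> s g w; apply: (@insertion_closed_nseq (C s) [:: a]).
  + apply: IHd => [s|s|s w H].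
    * apply: (@insertion_closed_cat (fun w => C s (nseq s z ++ w)) [:: a]).
      exact: insertion_closed_cat.
    * exact: letters_below_split.
    * by apply: Cmono; apply: insertion_closed_cons.
  + move=> g; apply: IHd => [s|s|s w]; last exact: Cmono.
    * apply: (@insertion_closed_cat (fun w => C s (nseq g z ++ w)) [:: a]).
      exact: insertion_closed_cat.
    * exact: letters_below_split.
  by exists S => _ s /H.
exists (maxn S0 S1) => s; rewrite geq_max => /andP[S0s S1s] w.
have [->|[g [a [w' [az ->]]]]] := nseq_or_split w.
  by rewrite (H0 s) // [RHS]H0 ?leq_maxl.
by rewrite (H1 a az s) // [RHS]H1 ?leq_maxr.
Qed.

Definition word_count U (n : nat) : int := #|[set t : n.-tuple L | U t]|.

Lemma eq_word_count U U' n : U =1 U' -> word_count U n = word_count U' n.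
Proof. by move=> H; congr Posz; apply: eq_card => t; rewrite !inE H. Qed.

Lemma word_countS U n :
  word_count U n.+1 = \sum_a word_count (fun w => U (a :: w)) n.
Proof.
rewrite /word_count -sum1dep_card -(big_morph Posz PoszD (erefl 0)).
congr Posz; under [RHS]eq_bigr => a _ do rewrite -sum1dep_card.
rewrite pair_big_dep /=.
rewrite (reindex (fun p : L * n.-tuple L => [tuple of p.1 :: p.2])) /=.
  by apply: eq_bigl => -[a t].
exists (fun t : n.+1.-tuple L => (thead t, [tuple of behead t])) => [[a t] _|t _].
  by congr pair; apply: val_inj.
by rewrite /= -tuple_eta.
Qed.

Lemma word_count_ev_poly d U : insertion_closed U -> letters_below d U ->
  ev_poly (word_count U).
Proof.
elim: d U => [|d IHd] U Uins Ulet.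
  apply: eq_ev_poly ev_poly0 => n; congr Posz; apply/esym/eqP.
  by rewrite cards_eq0; apply/eqP/setP => t; rewrite !inE; apply/negP => /Ulet.
pose C g w := U (nseq g z ++ w).
have Cins g : insertion_closed (C g) by apply: insertion_closed_cat.
have Clet g : letters_below d.+1 (C g).
  move=> w /Ulet; rewrite count_cat; apply: leq_trans.
  by rewrite ltnS leq_addl.
have [|T HT] := insertion_chain_stabilizes Cins Clet.
  by move=> g; apply: (@insertion_closed_nseq U [::]).
have CS g n : word_count (C g) n.+1 = word_count (C g.+1) n
    + \sum_(a | a != z) word_count (fun w => C g (a :: w)) n.
  rewrite word_countS (bigD1 z) //=; congr (_ + _); apply: eq_word_count => w.
  by rewrite /C -[z :: w]cat1s catA -[[:: z]]/(nseq 1 z) -nseqD addn1.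
have ev_sum g : ev_poly
    (fun n => \sum_(a | a != z) word_count (fun w => C g (a :: w)) n).
  apply: ev_poly_sum => a az; apply: IHd; last exact: letters_below_split.
  exact: (@insertion_closed_cat (C g) [:: a]).
(* Descent from [g = T], where the chain is stationary, to [g = 0], where [C g] is [U]. *)
suff : forall m g, (g + m = T)%N -> ev_poly (word_count (C g)).
  by move=> /(_ T 0%N (add0n T)).
elim=> [|m IHm] g.
  (* As [C T] and [C T.+1] agree, [CS] identifies the first difference with the sum over the nonzero
     letters. *)
  rewrite addn0 => ->; apply: ev_poly_fdiff.
  apply: eq_ev_poly (ev_sum T) => n; rewrite /fdiff CS.
  by rewrite (eq_word_count n (HT _ (leqnSn T))) addrAC subrr add0r.
rewrite addnS -addSn => /IHm H; apply: ev_poly_succ.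
by apply: eq_ev_poly (ev_polyD H (ev_sum g)) => n; rewrite CS.
Qed.

End Words.

(** * Bases of standard elements *)

Section Span.
Variables (k : fieldType) (V : lmodType k) (I : finType) (e : I -> V).

Definition lspan (Q : pred I) (v : V) : Prop :=
  exists c : I -> k, v = \sum_(i | Q i) c i *: e i.

Lemma lspan_gen (Q : pred I) i : Q i -> lspan Q (e i).
Proof.
move=> Qi; exists (fun j => (j == i)%:R); rewrite (bigD1 i) //= eqxx scale1r.
by rewrite big1 ?addr0 // => j /andP[_ /negbTE ->]; rewrite scale0r.
Qed.

Lemma lspan0 Q : lspan Q 0.
Proof. by exists (fun=> 0); rewrite big1 // => i _; rewrite scale0r. Qed.

Lemma lspan_linear Q a u v : lspan Q u -> lspan Q v -> lspan Q (a *: u + v).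
Proof.
move=> [c ->] [c' ->]; exists (fun i => a * c i + c' i).
rewrite scaler_sumr -big_split; apply: eq_bigr => i _ /=.
by rewrite scalerDl scalerA.
Qed.

Lemma lspan_sum Q (J : Type) (s : seq J) (R : pred J) (c : J -> k) (F : J -> V) :
  (forall j, R j -> lspan Q (F j)) -> lspan Q (\sum_(j <- s | R j) c j *: F j).
Proof.
move=> H; elim/big_rec: _ => [|j v Rj Qv]; first exact: lspan0.
exact: lspan_linear (H j Rj) Qv.
Qed.

Variables (disp : Order.disp_t) (T : orderType disp) (f : I -> T).
Hypothesis f_inj : injective f.

Definition standard (i : I) : bool := ~~ `[< lspan (fun j => f j < f i)%O (e i) >].

(** Strong induction on the number of indices below [i]: a nonstandard element is rewritten through
    elements with fewer indices below them. *)
Lemma lspan_standard i : lspan standard (e i).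
Proof.
have [m] := ubnP #|[set j | (f j < f i)%O]|.
elim: m i => // m IHm i im; have [/lspan_gen//|] := boolP (standard i).
rewrite negbK => /asboolP[c ->]; apply: lspan_sum => j ji; apply: IHm.
rewrite ltnS in im; apply: leq_trans im; apply: proper_card; apply/properP.
split; first by apply/subsetP => l; rewrite !inE => /lt_trans; apply.
by exists j; rewrite inE ?ji ?ltxx.
Qed.

(** A nontrivial relation could be solved for its largest index with nonzero coefficient; as [f] is
    injective, the other indices are strictly smaller, contradicting standardness. *)
Lemma standard_free c : \sum_(i | standard i) c i *: e i = 0 ->
  forall i, standard i -> c i = 0.
Proof.
move=> c0 i0 st0; apply/eqP; apply: contraT => ci0.
have H0 : standard i0 && (c i0 != 0) by rewrite st0 ci0.
pose Q i := standard i && (c i != 0).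
case: (@arg_maxP _ _ _ i0 Q f H0) => i /andP[sti ci] imax.
case/asboolP: (sti).
exists (fun j => if standard j then - (c i)^-1 * c j else 0).
have -> : e i = - (c i)^-1 *: (\sum_(j | standard j && (j != i)) c j *: e j).
  move/eqP: c0; rewrite (bigD1 i) //= addrC addr_eq0 => /eqP ->.
  by rewrite scaleNr scalerN opprK scalerA mulVf // scale1r.
rewrite scaler_sumr big_mkcond [RHS]big_mkcond; apply: eq_bigr => j _.
have [stj|nstj] /= := boolP (standard j); last by rewrite scale0r if_same.
rewrite scalerA; have [->|ji] /= := eqVneq j i; first by rewrite ltxx.
have [//|ij] := ltP (f j) (f i); have [->|cj] := eqVneq (c j) 0.
  by rewrite mulr0 scale0r.
have := imax j; rewrite /Q stj cj => /(_ isT) ji'.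
by case/eqP: ji; apply: f_inj; apply/eqP; rewrite eq_le; apply/andP.
Qed.

Lemma has_dim_standard : has_dim (lspan predT) #|[set i | standard i]|.
Proof.
have sumE (F : I -> V) : \sum_(i | standard i) F i =
    \sum_(l < #|[set i | standard i]|) F (enum_val l).
  by rewrite -big_enum_val; apply: eq_bigl => i; rewrite inE.
exists (fun l => e (enum_val l)); split=> [l|c c0 l|v [c ->]].
- exact: lspan_gen.
- pose c' i := c (enum_rank_in (enum_valP l) i).
  have c'E m : c' (enum_val m) = c m by rewrite /c' enum_valK_in.
  rewrite -c'E; apply: standard_free; last by have := enum_valP l; rewrite inE.
  by rewrite sumE -[RHS]c0; apply: eq_bigr => m _; rewrite c'E.
- have [c' ->] : lspan standard (\sum_i c i *: e i).
    by apply: lspan_sum => i _; apply: lspan_standard.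
  by exists (fun l => c' (enum_val l)); rewrite sumE.
Qed.
End Span.

(** * Lexicographic order and insertion of a letter *)

Section LexInsert.
Variables (disp : Order.disp_t) (L : orderType disp).

Definition seqlt (s t : seq L) : bool := ((s : seqlexi L) < (t : seqlexi L))%O.

Lemma seqlt_insert (a : L) s1 s2 t1 t2 : size s1 = size t1 ->
  seqlt (s1 ++ a :: s2) (t1 ++ a :: t2) = seqlt (s1 ++ s2) (t1 ++ t2).
Proof.
rewrite /seqlt; elim: s1 t1 => [|x s1 IHs] [|y t1] //= => [_|[/IHs H]].
  by rewrite ltxi_cons lexx.
by rewrite !ltxi_cons H.
Qed.
End LexInsert.

(** * Killing one column of variables *)

(** Reduces the identities about [kill_col] below to constants and variables. *)
Lemma mpoly_rmorph_ext (m : nat) (R : comNzRingType) (A : nzRingType)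
    (f g : {rmorphism {mpoly R[m]} -> A}) :
  (forall c, f c%:MP = g c%:MP) -> (forall i, f 'X_i = g 'X_i) -> f =1 g.
Proof.
move=> fgC fgX q; rewrite [q]mpolyE !rmorph_sum; apply: eq_bigr => u _.
rewrite -mul_mpolyC !rmorphM fgC; congr (_ * _); rewrite mpolyXE_id.
by rewrite !rmorph_prod; apply: eq_bigr => i _; rewrite !rmorphXn fgX.
Qed.

Section Kill.
Variables (k : fieldType) (r n : nat) (p : 'I_n.+1).

Definition kill_var (v : 'I_(r * n.+1)) : {mpoly k[r * n]} :=
  mxvec (\matrix_(i < r, j < n.+1)
    if unlift p j is Some j' then 'X_(mxvec_index i j') else 0) 0 v.

Lemma kill_varE i j : kill_var (mxvec_index i j) =
  if unlift p j is Some j' then 'X_(mxvec_index i j') else 0.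
Proof. by rewrite /kill_var mxvecE mxE. Qed.

Definition kill_col (q : {mpoly k[r * n.+1]}) : {mpoly k[r * n]} :=
  q \mPo [tuple kill_var v | v < r * n.+1].

HB.instance Definition _ := GRing.LRMorphism.copy kill_col
  (comp_mpoly [tuple kill_var v | v < r * n.+1]).

Lemma killX v : kill_col 'X_v = kill_var v.
Proof. by rewrite /kill_col comp_mpolyXU -tnth_nth tnth_mktuple. Qed.

(** [lift_perm p p s] fixes [p] and acts as [s] on the other columns, so every [s] is induced from
    $S_{n+1}$. Hence killing a column sends invariants to invariants. *)
Lemma kill_diag_act (s : 'S_n) q :
  kill_col (diag_act (lift_perm p p s) q) = diag_act s (kill_col q).
Proof.
move: q; apply: (@mpoly_rmorph_ext _ _ _ (kill_col \o @msym _ _ _)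
                   (@msym _ _ _ \o kill_col)) => [c|v] /=.
  by rewrite -!alg_mpolyC !linearZ /= !rmorph1.
case/mxvec_indexP: v => i j.
rewrite -/(diag_act _ 'X__) -/(diag_act s _) diag_actX !killX !kill_varE.
case: (unliftP p j) => [j' ->|->]; last first.
  by rewrite lift_perm_id unlift_none /diag_act rmorph0.
by rewrite lift_perm_lift liftK diag_actX.
Qed.

Lemma kill_coeff0 q : (kill_col q)@_0%MM = q@_0%MM.
Proof.
move: q; apply: (@mpoly_rmorph_ext _ _ _ (mcoeff 0%MM \o kill_col) (mcoeff 0%MM)).
  by move=> c /=; rewrite /kill_col comp_mpolyC !mcoeffC !eqxx.
move=> v /=; rewrite killX; case/mxvec_indexP: v => i j; rewrite kill_varE.
have U0 m (l : 'I_m) : (U_(l) == 0)%MM = false.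
  by apply/negP => /eqP/mnmP/(_ l); rewrite mnm1E mnm0E eqxx.
by case: (unlift p j) => [j'|]; rewrite ?mcoeff0 !mcoeffX !U0.
Qed.

Lemma kill_ideal q : diag_ideal q -> diag_ideal (kill_col q).
Proof.
move=> /asboolP[qf qfP ->]; apply/asboolP.
exists [seq (kill_col x.1, kill_col x.2) | x <- qf].
  move=> _ /mapP[x /qfP[xinv x0] ->] /=; split; last by rewrite kill_coeff0.
  by move=> s; rewrite -kill_diag_act xinv.
by rewrite big_map rmorph_sum; apply: eq_bigr => x _; rewrite rmorphM.
Qed.
End Kill.

(** * Standard words in the coinvariant algebra *)

Lemma nth_lift (T : Type) (x0 : T) (u v : seq T) a n (p : 'I_n.+1) (j : 'I_n) :
  size u = p -> nth x0 (u ++ a :: v) (lift p j) = nth x0 (u ++ v) j.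
Proof.
move=> up; rewrite !nth_cat up /= /bump; have [pj|jp] := leqP p j.
  by rewrite add1n ltnNge leqW //= subSn.
by rewrite add0n jp.
Qed.

Section WordMonomials.
Variables (k : fieldType) (r : nat) (J : 'I_r -> nat).
Variables (disp : Order.disp_t) (L : finOrderType disp).
(* The letters encode exponent vectors; [z] encodes the zero vector. *)
Variables (dec : L -> 'I_r -> nat) (z : L).
Hypothesis dec_z : forall a, (a == z) = [forall i, dec a i == 0%N].
Hypothesis dec_onto : forall g : 'I_r -> nat, (forall i, (g i <= J i)%N) ->
  exists a, dec a =1 g.

Definition word_mnm n (w : seq L) : 'X_{1..r * n} :=
  [multinom (mxvec (\matrix_(i < r, j < n) dec (nth z w j) i) 0 v)%R | v < r * n].

Lemma word_mnmE n w i j : word_mnm n w (mxvec_index i j) = dec (nth z w j) i.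
Proof. by rewrite mnmE mxvecE mxE. Qed.

Definition has_multidegree (w : seq L) : bool :=
  [forall i, \sum_(a <- w) dec a i == J i]%N.

Lemma has_multidegree_insert u v :
  has_multidegree (u ++ z :: v) = has_multidegree (u ++ v).
Proof.
apply: eq_forallb => i; rewrite !big_cat big_cons /=.
have := dec_z z; rewrite eqxx => /esym/forallP/(_ i)/eqP ->.
by rewrite add0n.
Qed.

Lemma multidegree_word_mnm n (w : seq L) i : size w = n ->
  multidegree (word_mnm n w) i = (\sum_(a <- w) dec a i)%N.
Proof.
move=> <-; rewrite (big_nth z) big_mkord.
by apply: eq_bigr => j _; rewrite word_mnmE.
Qed.

(** Each nonzero letter contributes at least 1 to the total degree $|J|$. *)
Lemma count_letters w : has_multidegree w ->
  (count (predC1 z) w < (\sum_i J i).+1)%N.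
Proof.
move=> /forallP wJ; rewrite ltnS -(eq_bigr _ (fun i _ => eqP (wJ i))).
rewrite exchange_big -sum1_count big_mkcond; apply: leq_sum => a _ /=.
rewrite dec_z; case: ifP => // /forallPn[i ai].
by rewrite (bigD1 i) //= ltn_addr // lt0n.
Qed.

Lemma prod_mxvec_index n (A : comNzRingType) (h : 'I_(r * n) -> A)
    (m : 'X_{1..r * n}) :
  \prod_(v < r * n) h v ^+ m v =
  \prod_(i < r) \prod_(j < n) h (mxvec_index i j) ^+ m (mxvec_index i j).
Proof.
by rewrite (reindex _ (curry_mxvec_bij _ _)) pair_bigA; apply: eq_bigr => -[].
Qed.

Lemma kill_word_mnm n (p : 'I_n.+1) u a v : size u = p ->
  kill_col p 'X_[k, word_mnm n.+1 (u ++ a :: v)] =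
  if a == z then 'X_[word_mnm n (u ++ v)] else 0.
Proof.
move=> up; rewrite /kill_col comp_mpolyX prod_mxvec_index.
have nthp : nth z (u ++ a :: v) p = a by rewrite nth_cat up ltnn subnn.
(* Column [p] contributes the factors [0 ^+ dec a i]: all are 1 if [a] is the zero letter, and one
   of them vanishes otherwise. *)
under eq_bigr => i _.
  rewrite (bigD1_ord p) //= tnth_mktuple kill_varE unlift_none word_mnmE nthp.
  under eq_bigr => j _ do
    rewrite tnth_mktuple kill_varE liftK word_mnmE nth_lift // -word_mnmE.
  over.
rewrite dec_z; case: ifP => [/forallP a0|/forallPn[i ai]].
  rewrite mpolyXE_id prod_mxvec_index; apply: eq_bigr => i _.
  by rewrite (eqP (a0 i)) mul1r.
by rewrite (bigD1 i) //= expr0n (negbTE ai) !mul0r.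
Qed.

(** The value 0 in the wrong multidegree lets all words of length [n] serve as index set: the class
    0 lies in every span, so such words are never standard. *)
Definition word_poly n (w : seq L) : {mpoly k[r * n]} :=
  if has_multidegree w then 'X_[word_mnm n w] else 0.

Lemma kill_word_poly n (p : 'I_n.+1) u a v : size u = p ->
  kill_col p (word_poly n.+1 (u ++ a :: v)) =
  if a == z then word_poly n (u ++ v) else 0.
Proof.
move=> up; rewrite /word_poly; have [->|az] := eqVneq a z.
  rewrite has_multidegree_insert; case: ifP => _; last by rewrite rmorph0.
  by rewrite kill_word_mnm // eqxx.
case: ifP => _; last by rewrite rmorph0.
by rewrite kill_word_mnm // (negbTE az).
Qed.

Definition word_class n (w : seq L) : coinv k r n := coinv_pi (word_poly n w).

Definition below n (w : seq L) : pred (n.-tuple L) := fun t => seqlt t w.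

(** A single predicate on words of all lengths, as insertion changes the length; [standard_wordE]
    links it to [standard] at fixed length. *)
Definition standard_word (w : seq L) : bool :=
  ~~ `[< lspan (fun t : (size w).-tuple L => word_class (size w) t)
           (below w) (word_class (size w) w) >].

Lemma standard_wordE n (t : n.-tuple L) : standard_word t =
  standard (fun t : n.-tuple L => word_class n t)
           (fun t => tval t : seqlexi L) t.
Proof. by rewrite /standard_word size_tuple. Qed.

(** Either the letter of [t] at [p] is nonzero and the monomial dies, or deleting this zero letter
    from both words preserves their order by [seqlt_insert]. *)
Lemma kill_below n (p : 'I_n.+1) u v (t : n.+1.-tuple L) : size u = p ->
  below (u ++ z :: v) t ->
  lspan (fun t : n.-tuple L => word_class n t) (below (u ++ v))
    (coinv_pi (kill_col p (word_poly n.+1 t))).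
Proof.
move=> up; rewrite /below => tlt.
have pt : (p < size t)%N by rewrite size_tuple.
have [u' [a [v' [tE u'p sz]]]] : exists u' a v',
    [/\ tval t = u' ++ a :: v', size u' = p & size (u' ++ v') == n].
  exists (take p t), (nth z t p), (drop p.+1 t).
  have szp : size (take p t) = p by rewrite size_takel // ltnW.
  split=> //; first by rewrite -drop_nth // cat_take_drop.
  by rewrite size_cat szp size_drop size_tuple subSS subnKC // -ltnS.
move: tlt; rewrite tE kill_word_poly //.
have [->|_ _] := eqVneq; last by rewrite rmorph0; apply: lspan0.
rewrite seqlt_insert ?u'p // => tlt.
exact: (@lspan_gen _ _ _ (fun t : n.-tuple L => word_class n t) _ (Tuple sz)).
Qed.

Lemma standard_word_insertion_closed : insertion_closed z standard_word.
Proof.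
move=> u v; apply: contra => /asboolP; rewrite size_cat /= addnS -size_cat.
set n := size (u ++ v) => -[c]; set w := u ++ z :: v => wE; apply/asboolP.
have un : (size u < n.+1)%N by rewrite ltnS /n size_cat leq_addr.
pose p := Ordinal un.
(* The relation between classes is lifted to a polynomial in the ideal, since [kill_col] acts on
   polynomials. *)
have : coinv_pi (word_poly n.+1 w -
    \sum_(t | below w t) c t *: word_poly n.+1 t) == 0.
  rewrite rmorphB rmorph_sum /= subr_eq0; apply/eqP; rewrite [LHS]wE.
  by apply: eq_bigr => t _; rewrite coinv_piZ.
rewrite coinv_pi_eq0 => /(kill_ideal p).
have -> : kill_col p (word_poly n.+1 w -
      \sum_(t | below w t) c t *: word_poly n.+1 t)
    = word_poly n (u ++ v) -
      \sum_(t | below w t) c t *: kill_col p (word_poly n.+1 t).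
  rewrite rmorphB (rmorph_sum (kill_col p)); congr (_ - _).
    by rewrite [LHS]kill_word_poly // eqxx.
  by apply: eq_bigr => t _; apply: linearZ.
rewrite -coinv_pi_eq0 rmorphB subr_eq0 => /eqP; rewrite /word_class => ->.
rewrite (rmorph_sum (@coinv_pi k r n)) /=.
under eq_bigr => t _ do rewrite coinv_piZ.
by apply: lspan_sum => t; apply: kill_below.
Qed.

Lemma standard_word_letters : letters_below z (\sum_i J i).+1 standard_word.
Proof.
move=> w stw; apply: count_letters; apply: contraT => nJ.
case/asboolP: stw; rewrite /word_class /word_poly (negbTE nJ) rmorph0.
exact: lspan0.
Qed.

Lemma multihomog_word_poly n (t : n.-tuple L) : multihomog J (word_poly n t).
Proof.
rewrite /word_poly; case: ifP => [/forallP tJ|_] m; last by rewrite msupp0.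
rewrite msuppX inE => /eqP -> i.
by rewrite multidegree_word_mnm ?size_tuple //; apply/eqP.
Qed.

Lemma word_poly_onto n (m : 'X_{1..r * n}) : multidegree m =1 J ->
  exists t : n.-tuple L, word_poly n t = 'X_[m].
Proof.
move=> mJ.
(* The exponents in row [i] sum to [J i], so each column is bounded by [J] and is encoded by a
   letter. *)
have [|g gE] := @choice 'I_n L (fun j a => dec a =1 fun i => m (mxvec_index i j)).
  move=> j; apply: dec_onto => i; rewrite -mJ /multidegree (bigD1 j) //=.
  exact: leq_addr.
have tE : word_mnm n [tuple g j | j < n] = m.
  apply/mnmP => v; case/mxvec_indexP: v => i j.
  by rewrite word_mnmE -tnth_nth tnth_mktuple gE.
exists [tuple g j | j < n]; rewrite /word_poly tE ifT //.
apply/forallP => i; apply/eqP.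
by rewrite -(@multidegree_word_mnm n) ?size_tuple // tE.
Qed.

Lemma coinv_pieceE n : @coinv_piece k r n J =
  lspan (fun t : n.-tuple L => word_class n t) predT.
Proof.
apply/funext => x; apply/propext; split=> [[q qJ ->]|[c ->]].
  rewrite [q]mpolyE rmorph_sum /= big_seq.
  under eq_bigr => m _ do rewrite coinv_piZ.
  apply: lspan_sum => m /qJ/word_poly_onto[t <-].
  exact: (@lspan_gen _ _ _ (fun t : n.-tuple L => word_class n t)).
elim/big_rec: _ => [|t y _]; first exact: coinv_piece0.
apply: coinv_piece_linear; exists (word_poly n t) => //.
exact: multihomog_word_poly.
Qed.

Lemma has_dim_coinv_piece n :
  has_dim (@coinv_piece k r n J) #|[set t : n.-tuple L | standard_word t]|.
Proof.
rewrite coinv_pieceE; under eq_finset => t do rewrite standard_wordE.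
by apply: has_dim_standard; apply: val_inj.
Qed.

Lemma dim_coinv_piece_ev_poly : exists P : {poly rat}, int_valued P /\
  exists N : nat, forall n : nat, (N <= n)%N ->
    exists2 d : nat, has_dim (@coinv_piece k r n J) d & P.[n%:R] = d%:R.
Proof.
have [P [Pint [N PE]]] := ev_polyP
  (word_count_ev_poly standard_word_insertion_closed standard_word_letters).
exists P; split=> //; exists N => n /PE Pn.
by eexists; [apply: has_dim_coinv_piece | rewrite Pn].
Qed.

End WordMonomials.

Theorem theorem1p12 (k : fieldType) (r : nat) (r_gt0 : (0 < r)%N)
    (J : 'I_r -> nat) :
  exists P : {poly rat},
    (forall z : int, P.[z%:~R] \is a Num.int) /\
    (exists N : nat, forall n : nat, (N <= n)%N ->
       exists2 d : nat, has_dim (@coinv_piece k r n J) d & P.[n%:R] = d%:R).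
Proof.
(* Exponent vectors with entries at most [M] form a finite alphabet containing every vector bounded
   by [J]; the lexicographic order on tuples makes it totally ordered. *)
pose M := (\max_i J i)%N.
pose dec (a : r.-tuplelexi 'I_M.+1) i : nat := tnth a i.
apply: (@dim_coinv_piece_ev_poly k r J _ _ dec [tuple ord0 | i < r]) => [a|g gJ].
  apply/eqP/forallP => [-> i|a0]; first by rewrite /dec tnth_mktuple.
  by apply: eq_from_tnth => i; rewrite tnth_mktuple; apply/val_inj/eqP/a0.
exists [tuple inord (g i) | i < r] => i; rewrite /dec tnth_mktuple inordK // ltnS.
exact: leq_trans (gJ i) (leq_bigmax i).
Qed.
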